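(* Let $g:\mathbb{R}^m\to\mathbb{R}$ be a (not necessarily convex) Fréchet differentiable function whose gradient is $L_g$-Lipschitz continuous ($L_g\ge 0$), and assume $g$ is bounded from below. Let $\alpha>0$, $\beta\in(0,1)$, $0<s<\frac{2(1-\beta)}{L_g}$, and let $(x_n)_{n\in\mathbb{N}}$, $(y_n)_{n\in\mathbb{N}}$ be the sequences generated from a starting point $x_0=y_0\in\mathbb{R}^m$ by $$x_{n+1}=y_n-s\nabla g(y_n)\ (n\ge 0),\qquad y_n=x_n+\frac{\beta n}{n+\alpha}(x_n-x_{n-1})\ (n\ge 1).$$ Let $H:\mathbb{R}^m\times\mathbb{R}^m\to\mathbb{R}$, $H(x,y)=g(x)+\frac12\|y-x\|^2$. Assume that $(x_n)_{n\in\mathbb{N}}$ is bounded and that $H$ is a KL function. Then: (a) $\sum_{n\ge 1}\|x_n-x_{n-1}\|<+\infty$; (b) there exists $x\in\operatorname{crit}(g)$ such that $\lim_{n\to+\infty}x_n=x$.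
   Context: $\|\cdot\|$ is the Euclidean norm; $\mathbb{N}=\{0,1,2,\dots\}$; $\operatorname{crit}(g)=\{x\in\mathbb{R}^m:\nabla g(x)=0\}$. ''$L_g$-Lipschitz continuous gradient'' means $\|\nabla g(x)-\nabla g(y)\|\le L_g\|x-y\|$ for all $x,y$. The condition $0<s<\frac{2(1-\beta)}{L_g}$ is read as $s>0$ and $sL_g<2(1-\beta)$ (so when $L_g=0$ any $s>0$ is allowed). KL functions: for $\eta\in(0,+\infty]$, let $\Theta_\eta$ be the class of concave and continuous functions $\varphi:[0,\eta)\to[0,+\infty)$ such that $\varphi(0)=0$, $\varphi$ is continuously differentiable on $(0,\eta)$, continuous at $0$, and $\varphi'(t)>0$ for all $t\in(0,\eta)$. A differentiable function $f:\mathbb{R}^k\to\mathbb{R}$ satisfies the Kurdyka-Łojasiewicz (KL) property at $\overline{x}\in\mathbb{R}^k$ if there exist $\eta\in(0,+\infty]$, a neighborhood $U$ of $\overline{x}$ and $\varphi\in\Theta_\eta$ such that for all $x\in U\cap\{x\in\mathbb{R}^k: f(\overline{x})<f(x)<f(\overline{x})+\eta\}$ one has $\varphi'(f(x)-f(\overline{x}))\,\|\nabla f(x)\|\ge 1$. If $f$ satisfies the KL property at each point of $\mathbb{R}^k$, then $f$ is called a KL function. (Here this is applied to $H$ on $\mathbb{R}^m\times\mathbb{R}^m\cong\mathbb{R}^{2m}$.) *)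

(* Defs.v *)
From mathcomp Require Import all_boot all_order all_algebra.
From mathcomp Require Import all_classical all_reals all_analysis.
Set Implicit Arguments.
Unset Strict Implicit.
Unset Printing Implicit Defensive.
Import Order.TTheory GRing.Theory Num.Theory.
Import numFieldNormedType.Exports.
Local Open Scope classical_set_scope.
Local Open Scope ring_scope.

(* The library norm `|x| on 'rV[R]_m is the sup norm, hence this definition.
   Both norms induce the same topology and the same Frechet differentials, so
   [differentiable], [nbhs] and [-->] are taken from the library. *)
Definition enorm (R : realType) (m : nat) (x : 'rV[R]_m) : R :=
  Num.sqrt (\sum_(i < m) x 0 i ^+ 2).

(* 'D_v f is total; [gradient f x] is the gradient when [differentiable f x]. *)
Definition gradient (R : realType) (m : nat) (f : 'rV[R]_m -> R)
    (x : 'rV[R]_m) : 'rV[R]_m :=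
  \row_(i < m) 'D_(delta_mx 0 i) f x.

Definition crit (R : realType) (m : nat) (f : 'rV[R]_m -> R) : set 'rV[R]_m :=
  [set x | gradient f x = 0].

(* [eta] may be +oo. A function on [0, eta[ is encoded as a total function
   [phi], of which only the values on [0, eta[ are constrained. *)
Definition desingularizing (R : realType) (eta : \bar R) (phi : R -> R) : Prop :=
  let D := [set t : R | 0 <= t /\ (t%:E < eta)%E] in
  [/\ forall t : R, D t -> 0 <= phi t,
      convex_function (D : set R^o) (fun t => - phi t),
      {within D, continuous phi},
      phi 0 = 0
    & forall t : R, 0 < t -> (t%:E < eta)%E ->
        [/\ derivable phi t 1, {for t, continuous (derive1 phi)} & 0 < derive1 phi t]].

Definition KL_at (R : realType) (k : nat) (f : 'rV[R]_k -> R)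
    (xbar : 'rV[R]_k) : Prop :=
  exists (eta : \bar R) (U : set 'rV[R]_k) (phi : R -> R),
    [/\ (0 < eta)%E, nbhs xbar U, desingularizing eta phi
      & forall x, U x -> f xbar < f x -> ((f x)%:E < (f xbar)%:E + eta)%E ->
          1 <= derive1 phi (f x - f xbar) * enorm (gradient f x)].

Definition KL_function (R : realType) (k : nat) (f : 'rV[R]_k -> R) : Prop :=
  (forall x, differentiable f x) /\ (forall x, KL_at f x).

Definition H (R : realType) (m : nat) (g : 'rV[R]_m -> R)
    (x y : 'rV[R]_m) : R :=
  g x + 1 / 2 * enorm (y - x) ^+ 2.

(* R^m x R^m is identified with R^(2m) by concatenating row vectors; this makes
   the norm of the gradient of a function on the product Euclidean. *)
Definition on_product (R : realType) (m : nat) (F : 'rV[R]_m -> 'rV[R]_m -> R)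
    (z : 'rV[R]_(m + m)) : R :=
  F (lsubmx z) (rsubmx z).

(* Main.v *)
(* Write v_n = x_n - x_(n-1). The descent lemma between y_n and y_(n+1), expressed
   through v_n and v_(n+1), shows that for a suitable constant delta > 0 the energy
   E_n = g(y_n) + delta |v_n|^2 eventually drops by at least
   D (|v_n|^2 + |v_(n+1)|^2) at each step; the bound on s is exactly what makes
   D > 0 possible. With kappa^2 = 2 delta and z_n = (y_n, y_n + kappa v_n) one has
   E_n = H(z_n) and |grad H(z_n)| <= C (|v_n| + |v_(n+1)|). The KL inequality at
   (xbar, xbar), where xbar is a cluster point of x, then gives
   |v_n| + |v_(n+1)| <= (2C/D) (phi(r_n) - phi(r_(n+1))) with r_n = E_n - lim E, as
   long as x_n stays near xbar. The right-hand side telescopes, which both keeps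
   x_n near xbar and makes its length finite. *)

Require Import Defs.
From mathcomp Require Import all_boot all_order all_algebra.
From mathcomp Require Import all_classical all_reals all_analysis.
From mathcomp Require Import ring lra.
Import Order.TTheory GRing.Theory Num.Theory.
Import numFieldNormedType.Exports.
Local Open Scope classical_set_scope.
Local Open Scope ring_scope.

(** * Euclidean inner product and norm, and comparison with the sup norm *)

Definition dot {R : realType} {m : nat} (u v : 'rV[R]_m) : R :=
  \sum_(i < m) u 0 i * v 0 i.

Section Euclidean.
Context {R : realType} {m : nat}.
Implicit Types (u v w : 'rV[R]_m) (a : R).

Lemma dotC u v : dot u v = dot v u.
Proof. by apply: eq_bigr => i _; rewrite mulrC. Qed.

Lemma dotDl u v w : dot (u + v) w = dot u w + dot v w.
Proof. by rewrite -big_split; apply: eq_bigr => i _; rewrite mxE mulrDl. Qed.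

Lemma dotZl a u v : dot (a *: u) v = a * dot u v.
Proof. by rewrite mulr_sumr; apply: eq_bigr => i _; rewrite mxE mulrA. Qed.

Lemma dotNl u v : dot (- u) v = - dot u v.
Proof. by rewrite -scaleN1r dotZl mulN1r. Qed.

Lemma dotDr u v w : dot u (v + w) = dot u v + dot u w.
Proof. by rewrite dotC dotDl !(dotC u). Qed.

Lemma dotZr a u v : dot u (a *: v) = a * dot u v.
Proof. by rewrite dotC dotZl dotC. Qed.

Lemma dotNr u v : dot u (- v) = - dot u v.
Proof. by rewrite dotC dotNl dotC. Qed.

Lemma dot0l u : dot 0 u = 0.
Proof. by rewrite -(scale0r 0) dotZl mul0r. Qed.

Definition dotE := (dotDl, dotDr, dotNl, dotNr, dotZl, dotZr).

Lemma enorm_ge0 u : 0 <= enorm u.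
Proof. exact: sqrtr_ge0. Qed.

Lemma enorm_sqr u : enorm u ^+ 2 = dot u u.
Proof.
rewrite sqr_sqrtr; last by apply: sumr_ge0 => i _; exact: sqr_ge0.
by apply: eq_bigr => i _; rewrite expr2.
Qed.

Lemma coord_le_enorm u i : `|u 0 i| <= enorm u.
Proof.
rewrite -sqrtr_sqr ler_wsqrtr// (bigD1 i)//= lerDl.
by apply: sumr_ge0 => j _; exact: sqr_ge0.
Qed.

Lemma norm_le_enorm u : `|u| <= enorm u.
Proof.
rewrite {1}/Num.norm/= mx_normrE; apply: bigmax_le; first exact: enorm_ge0.
by move=> [i j] _ /=; rewrite ord1; exact: coord_le_enorm.
Qed.

Lemma coord_le_norm u i : `|u 0 i| <= `|u|.
Proof. by rewrite {2}/Num.norm/= mx_normrE; exact: (le_bigmax _ _ (0, i)). Qed.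

(** Summing the [m] coordinate bounds gives the constant square root of [m]; the cruder [m] avoids a
    root and serves equally in limit arguments. *)
Lemma enorm_le_norm u : enorm u <= m%:R * `|u|.
Proof.
have m0 : 0 <= m%:R * `|u| by rewrite mulr_ge0.
rewrite -(ler_pXn2r (n := 2)) ?nnegrE ?enorm_ge0// enorm_sqr.
apply: (@le_trans _ _ (m%:R * `|u| ^+ 2)).
  rewrite mulr_natl -[X in _ *+ X]card_ord -sumr_const; apply: ler_sum => i _.
  by rewrite -expr2 -real_normK ?num_real// ler_pXn2r ?nnegrE// coord_le_norm.
rewrite exprMn ler_wpM2r ?sqr_ge0// -natrX ler_nat.
by case: m => // k; rewrite leq_pmulr.
Qed.

Lemma enorm0 : enorm (0 : 'rV[R]_m) = 0.
Proof. by apply/eqP; rewrite -sqrf_eq0 enorm_sqr dot0l. Qed.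

Lemma enormZ a u : enorm (a *: u) = `|a| * enorm u.
Proof.
apply/eqP; rewrite -(eqrXn2 (n := 2)) ?mulr_ge0 ?enorm_ge0//.
by rewrite exprMn !enorm_sqr !dotE real_normK ?num_real// mulrA expr2.
Qed.

Lemma enormN u : enorm (- u) = enorm u.
Proof. by rewrite -scaleN1r enormZ normrN1 mul1r. Qed.

Lemma enormB u v : enorm (u - v) = enorm (v - u).
Proof. by rewrite -enormN opprB. Qed.

Lemma enorm_eq0 u : enorm u = 0 -> u = 0.
Proof.
move=> u0; apply/eqP; rewrite -normr_eq0 eq_le normr_ge0 andbT -u0.
exact: norm_le_enorm.
Qed.

(** Cauchy-Schwarz: for nonzero vectors, expand the square of the norm of
    [enorm v *: u - enorm u *: v] and divide by twice the product of the norms. *)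
Lemma dot_le_enorm u v : dot u v <= enorm u * enorm v.
Proof.
have [/enorm_eq0->|u0] := eqVneq (enorm u) 0.
  by rewrite dot0l enorm0 mul0r.
have [/enorm_eq0->|v0] := eqVneq (enorm v) 0.
  by rewrite dotC dot0l enorm0 mulr0.
have := sqr_ge0 (enorm (enorm v *: u - enorm u *: v)).
rewrite enorm_sqr !dotE -!enorm_sqr (dotC v).
have : 0 < enorm u * enorm v by rewrite mulr_gt0// lt_def enorm_ge0 andbT.
nra.
Qed.

Lemma enormD u v : enorm (u + v) <= enorm u + enorm v.
Proof.
rewrite -(ler_pXn2r (n := 2)) ?nnegrE ?addr_ge0 ?enorm_ge0//.
rewrite sqrrD !enorm_sqr !dotE (dotC v).
by have := dot_le_enorm u v; lra.
Qed.

End Euclidean.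

(** * Derivatives along lines and the descent lemma *)

Section Calculus.
Context {R : realType} {m : nat}.
Implicit Types (f g : 'rV[R]_m -> R) (a b u v : 'rV[R]_m).

(** Both sides are limits of the same difference quotient; this lets the one-variable derivative
    rules compute directional derivatives. *)
Lemma is_derive_line f a v (t d : R) :
  is_derive t 1 (fun h => f (a + h *: v)) d <-> is_derive (a + t *: v) v f d.
Proof.
have E : (fun h : R => h^-1 *: (((fun r => f (a + r *: v)) \o shift t) (h *: 1)
             - f (a + t *: v))) =
         (fun h => h^-1 *: ((f \o shift (a + t *: v)) (h *: v)
             - f (a + t *: v))).
  apply/funext => h /=; congr (_ *: (f _ - _)).
  by rewrite scalerDl [h *: 1]mulr1 addrCA.
split=> -[]; rewrite /derivable /derive => c l; split.
- by rewrite /derivable -E.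
- by rewrite /derive -E.
- by rewrite /derivable E.
- by rewrite /derive E.
Qed.

Lemma derive_gradient f a v : differentiable f a ->
  'D_v f a = dot (gradient f a) v.
Proof.
move=> df; rewrite deriveE// {1}(row_sum_delta v) linear_sum.
apply: eq_bigr => i _; by rewrite linearZ/= mxE deriveE// mulrC.
Qed.

Lemma descent_lemma g (L : R) a b :
  (forall x, differentiable g x) ->
  (forall x y, enorm (gradient g x - gradient g y) <= L * enorm (x - y)) ->
  g b <= g a + dot (gradient g a) (b - a) + L / 2 * enorm (b - a) ^+ 2.
Proof.
move=> dg lipg; set d := b - a.
pose c1 := dot (gradient g a) d; pose c2 := L / 2 * enorm d ^+ 2.
(* [h] is [g] on the segment minus the increasing part of its quadratic model. Cauchy-Schwarz and
   the Lipschitz bound make its derivative nonpositive on ]0, 1[, and [h 1 <= h 0] is the claim. *)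
pose h t := g (a + t *: d) - (c1 * t + c2 * t ^+ 2).
pose dh t := dot (gradient g (a + t *: d)) d - (c1 + c2 * (2 * t)).
have hd (t : R) : is_derive t 1 h (dh t).
  have /is_derive_line h1 : is_derive (a + t *: d) d g
      (dot (gradient g (a + t *: d)) d).
    by apply: DeriveDef; [exact: diff_derivable|exact: derive_gradient].
  apply: is_derive_eq; rewrite /dh /GRing.scale/=; ring.

have h01 : h 1 <= h 0.
  apply: (@ler0_derive1_le_cc _ h 0 1); rewrite ?in_itv/= ?lexx ?ler01//.
  - move=> t /[!in_itv]/= /andP[t0 _]; rewrite derive1E derive_val /dh.
    have -> : dot (gradient g (a + t *: d)) d - (c1 + c2 * (2 * t)) =
      dot (gradient g (a + t *: d) - gradient g a) d - L * t * enorm d ^+ 2.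
      by rewrite dotDl dotNl /c1 /c2; field.
    rewrite subr_le0 (le_trans (dot_le_enorm _ _))//.
    have := lipg (a + t *: d) a; rewrite addrAC subrr add0r enormZ gtr0_norm//.
    by move=> /(ler_wpM2r (enorm_ge0 d)); rewrite expr2 !mulrA.
  - apply: continuous_subspaceT => t.
    exact/differentiable_continuous/derivable1_diffP.
have adb : a + d = b by rewrite addrC subrK.
move: h01; rewrite /h scale1r scale0r addr0 adb /c1 /c2.
by rewrite expr1n expr0n/=; lra.
Qed.

End Calculus.

(** * The gradient of [H] on the product space *)

Lemma derive_on_product_H {R : realType} {m : nat} (g : 'rV[R]_m -> R)
    (p q : 'rV[R]_m) (v : 'rV[R]_(m + m)) :
  (forall x, differentiable g x) ->
  'D_v (on_product (H g)) (row_mx p q) =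
  dot (gradient g p + (p - q)) (lsubmx v) + dot (q - p) (rsubmx v).
Proof.
move=> dg; set l := lsubmx v; set r := rsubmx v.
(* Along a line the quadratic part of [H] is exactly a polynomial of degree two with coefficients
   [c1] and [c2], so only [g] needs differentiability. *)
pose c1 := dot (q - p) (r - l); pose c2 := 1 / 2 * enorm (r - l) ^+ 2.
suff : is_derive (row_mx p q + 0 *: v) v (on_product (H g))
    (dot (gradient g p + (p - q)) l + dot (q - p) r).
  by rewrite scale0r addr0 => h; rewrite derive_val.
apply/is_derive_line.
have -> : (fun h : R => on_product (H g) (row_mx p q + h *: v)) =
    (fun h => g (p + h *: l) + (H g p q - g p + c1 * h + c2 * h ^+ 2)).
  apply/funext => h; rewrite /on_product /H !linearD !linearZ/=.
  rewrite row_mxKl row_mxKr -/l -/r.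
  rewrite addrACA -scalerDr.
  rewrite /c1 /c2 !enorm_sqr (dotDl (q - p)) !(dotDr _ (q - p)) !dotZl !dotZr.
  by rewrite (dotC (r - l)); field.
have /is_derive_line h1 : is_derive (p + 0 *: l) l g (dot (gradient g (p + 0 *: l)) l).
  by apply: DeriveDef; [exact: diff_derivable|exact: derive_gradient].
apply: is_derive_eq.
rewrite scale0r addr0 /c1 !dotE /GRing.scale/=; ring.
Qed.

Lemma norm_row_mx_le {R : realType} {m n : nat} (u : 'rV[R]_m) (v : 'rV[R]_n) :
  `|row_mx u v| <= `|u| + `|v|.
Proof.
rewrite {1}/Num.norm/= mx_normrE; apply: bigmax_le; first by rewrite addr_ge0.
move=> [i j] _ /=; rewrite ord1 mxE; case: splitP => k _.
- by rewrite ler_wpDr// coord_le_norm.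
- by rewrite ler_wpDl// coord_le_norm.
Qed.

Lemma enorm_row_mx_le {R : realType} {m n : nat} (u : 'rV[R]_m) (v : 'rV[R]_n) :
  enorm (row_mx u v) <= enorm u + enorm v.
Proof.
rewrite -(ler_pXn2r (n := 2)) ?nnegrE ?addr_ge0 ?enorm_ge0// sqrrD.
have -> : enorm (row_mx u v) ^+ 2 = enorm u ^+ 2 + enorm v ^+ 2.
  rewrite !enorm_sqr /dot big_split_ord/=.
  by congr (_ + _); apply: eq_bigr => i _; rewrite ?row_mxEl ?row_mxEr.
by rewrite addrAC lerDl mulrn_wge0// mulr_ge0 ?enorm_ge0.
Qed.

Lemma gradient_on_product_H {R : realType} {m : nat} (g : 'rV[R]_m -> R)
    (p q : 'rV[R]_m) :
  (forall x, differentiable g x) ->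
  gradient (on_product (H g)) (row_mx p q) = row_mx (gradient g p + (p - q)) (q - p).
Proof.
move=> dg; apply/rowP => i; rewrite [LHS]mxE derive_on_product_H//.
have dotdelta (u : 'rV[R]_(m + m)) j : dot u (delta_mx 0 j) = u 0 j.
  rewrite /dot (bigD1 j)//= mxE !eqxx mulr1 big1 ?addr0// => k kj.
  by rewrite mxE (negbTE kj) andbF mulr0.
rewrite -[RHS]dotdelta /dot big_split_ord/=.
congr (_ + _); apply: eq_bigr => j _.
  by rewrite row_mxEl [lsubmx _ _ _]mxE.
by rewrite row_mxEr [rsubmx _ _ _]mxE.
Qed.

(** * The KL inequality and finite length *)

Lemma desingularizing_tangent {R : realType} {eta : \bar R} {phi : R -> R}
    {a b : R} :
  desingularizing eta phi ->
  0 < a -> (a%:E < eta)%E -> 0 <= b -> (b%:E < eta)%E ->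
  phi b <= phi a + derive1 phi a * (b - a).
Proof.
move=> [_ cvx _ _ dphi] a0 ae b0 be; have [da _ _] := dphi _ a0 ae.
have dab : 'D_(b - a) phi a = derive1 phi a * (b - a).
  have dfa : differentiable phi a by exact/derivable1_diffP.
  rewrite derive1E !deriveE// -[X in 'd _ _ X = _]mulr1.
  by rewrite -/((b - a) *: 1) linearZ/= mulrC.
have cv : derivable phi a (b - a) by exact/diff_derivable/derivable1_diffP.
have cr : h^-1 * (phi (h * (b - a) + a) - phi a) @[h --> 0^'+] -->
    derive1 phi a * (b - a).
  by apply: cvg_dnbhs_at_right; rewrite -dab; exact: cv.
(* Concavity bounds the difference quotient below by [phi b - phi a] for all 0 < h <= 1, and the
   bound survives the limit at 0 from the right. *)
rewrite addrC -lerBlDr -(cvg_lim (@Rhausdorff R) cr).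
apply: limr_ge; first exact: cvgP cr.
near=> h; have h0 : 0 < h by near: h; exact: nbhs_right_gt.
have h1 : h <= 1 by near: h; apply: nbhs_right_le.
have /= := cvx (Itv01 (ltW h0) h1) b a.
rewrite !inE => /(_ (conj b0 be) (conj (ltW a0) ae)).
rewrite /conv/= => hc; rewrite ler_pdivlMl//.
have -> : h * (b - a) + a = h *: b + (1 - h) *: a.
  by rewrite /GRing.scale/=; ring.
have {hc} : - phi (h *: b + (1 - h) *: a) <= h * - phi b + (1 - h) * - phi a := hc.
lra.
Unshelve. all: end_near. Qed.

(** Here [P] stands for the slope of [phi] at [r], [G] for the gradient norm, [q] and [q'] for the
    values of [phi]. With w = v + v', multiplying 1 <= C P w by w and using w^2 <= 2 (v^2 + v'^2)
    bounds w linearly, without square roots. *)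
Lemma KL_step {R : realType} {C D v v' P G r r' q q' : R} :
  0 < C -> 0 < D -> 0 <= v -> 0 <= v' -> 0 < P -> 1 <= P * G ->
  G <= C * (v + v') -> D * (v ^+ 2 + v' ^+ 2) <= r - r' ->
  q' <= q + P * (r' - r) ->
  v + v' <= 2 * C / D * (q - q').
Proof.
move=> C0 D0 v0 v0' P0 PG GC Dr q'q; set w := v + v'.
have w0 : 0 <= w by rewrite addr_ge0.
have CPw : w <= C * P * w ^+ 2.
  rewrite expr2 mulrA -[leLHS]mul1r ler_wpM2r// (le_trans PG)//.
  by have := ler_wpM2l (ltW P0) GC; rewrite /w; lra.
have drop : P * (D * w ^+ 2 / 2) <= q - q'.
  apply: (@le_trans _ _ (P * (r - r'))); last by lra.
  rewrite ler_wpM2l ?(ltW P0)// (le_trans _ Dr)// -mulrA ler_wpM2l ?(ltW D0)//.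
  by have := sqr_ge0 (v - v'); rewrite /w; lra.
apply: (le_trans CPw); apply: (@le_trans _ _ (2 * C / D * (P * (D * w ^+ 2 / 2)))).
  by rewrite le_eqVlt; apply/orP; left; apply/eqP; field; rewrite gt_eqF.
by rewrite ler_wpM2l// !mulr_ge0 ?invr_ge0 ?ltW.
Qed.

(** The KL inequality is used along [z], while closeness and length are controlled along [x]; the
    hypothesis on neighborhoods of [zbar] transfers the former to the latter. *)
Lemma KL_finite_length {R : realType} {m k : nat} (f : 'rV[R]_k -> R)
    (zbar : 'rV[R]_k) (z : nat -> 'rV[R]_k) (xbar : 'rV[R]_m)
    (x : nat -> 'rV[R]_m) (v : nat -> R) (C D : R) (N0 : nat) :
  KL_at f zbar -> 0 < C -> 0 < D ->
  (forall n, 0 <= v n) ->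
  (forall n, `|x n.+1 - x n| <= v n.+1) ->
  (forall n, (N0 <= n)%N ->
    D * (v n ^+ 2 + v n.+1 ^+ 2) <= f (z n) - f (z n.+1)) ->
  (forall n, enorm (gradient f (z n)) <= C * (v n + v n.+1)) ->
  f (z n) @[n --> \oo] --> f zbar ->
  (forall U, nbhs zbar U -> exists2 rho, 0 < rho &
    \forall n \near \oo, `|x n - xbar| < rho -> U (z n)) ->
  (forall e N, 0 < e -> exists2 n, (N <= n)%N & `|x n - xbar| < e) ->
  exists M, forall n, \sum_(i < n) v i <= M.
Proof.
move=> [eta [U [phi [eta0 nU dphi KL]]]] C0 D0 v0 xv desc gradC cvf nearU clus.
pose r n := f (z n) - f zbar.
have r_cvg : r n @[n --> \oo] --> 0.
  by rewrite -(subrr (f zbar)); apply: cvgB => //; exact: cvg_cst.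
have r_dec n : (N0 <= n)%N -> r n.+1 <= r n.
  move=> Nn; rewrite /r lerD2r -subr_ge0; apply: le_trans (desc n Nn).
  by rewrite mulr_ge0 ?addr_ge0 ?sqr_ge0// ltW.
have r_mon n j : (N0 <= n)%N -> r (n + j)%N <= r n.
  move=> Nn; elim: j => [|j IH]; first by rewrite addn0.
  by rewrite addnS (le_trans (r_dec _ _))// (leq_trans Nn)// leq_addr.
have r_ge0 n : (N0 <= n)%N -> 0 <= r n.
  move=> Nn; rewrite -(cvg_lim (@Rhausdorff R) r_cvg).
  apply: limr_le; first by apply/cvg_ex; exists 0.
  by exists n => // j /= nj; rewrite -(subnKC nj); exact: r_mon.
have tail n M : (forall j, \sum_(n <= i < n + j) v i <= M) ->
    exists M', forall j, \sum_(i < j) v i <= M'.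
  move=> hM; exists (\sum_(0 <= i < n) v i + M) => j.
  rewrite -(big_mkord xpredT); apply: (@le_trans _ _ (\sum_(0 <= i < n + j) v i)).
    rewrite (@big_cat_nat _ _ _ j 0 (n + j)) ?leq_addl//= lerDl.
    exact: sumr_ge0.
  by rewrite (@big_cat_nat _ _ _ n) ?leq_addr//= lerD2l.
(* The KL inequality needs [r n] positive. If [r] vanishes once past [N0], monotonicity keeps it
   zero and the decrease forces every later [v] to vanish. *)
have [[n [Nn rn0]]|rneq0] := pselect (exists n, (N0 <= n)%N /\ r n = 0).
  have r0 j : r (n + j)%N = 0.
    apply/eqP; rewrite eq_le -{1}rn0 r_mon//= r_ge0//.
    by rewrite (leq_trans Nn)// leq_addr.
  have fz j : f (z (n + j)%N) = f zbar.
    by apply/eqP; rewrite -subr_eq0; apply/eqP; exact: r0.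
  apply: (tail n 0) => j; rewrite big_nat_cond big1// => i /andP[/andP[ni _] _].
  have := desc i (leq_trans Nn ni); rewrite -(subnKC ni) -addnS.
  rewrite !fz subrr pmulr_rle0// => h; apply/eqP; rewrite -sqrf_eq0 eq_le sqr_ge0 andbT.
  by apply: le_trans h; rewrite lerDl sqr_ge0.
have r_gt0 n : (N0 <= n)%N -> 0 < r n.
  move=> Nn; rewrite lt_def r_ge0// andbT; apply/eqP => rn0.
  by apply: rneq0; exists n.
have [e e0 eeta] : exists2 e : R, 0 < e & (e%:E <= eta)%E.
  case: (eta) eta0 => [t|_|//]; first by rewrite lte_fin => t0; exists t.
  by exists 1 => //; rewrite leey.
have r_eta : \forall n \near \oo, ((r n)%:E < eta)%E.
  near=> n; rewrite (lt_le_trans _ eeta)// lte_fin.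
  by near: n; exact: (cvgr_lt _ r_cvg).
have phir : phi (r n) @[n --> \oo] --> 0.
  have [_ _ /subspace_continuousP cphi phi0 _] := dphi.
  have cphi0 : phi t @[t --> within [set t | 0 <= t /\ (t%:E < eta)%E] (nbhs 0)]
      --> phi 0.
    by apply: cphi; split.
  rewrite phi0 in cphi0.
  apply: cvg_comp cphi0 => P /= /r_cvg; rewrite /= !near_simpl => hP.
  near=> n; have : [set t | 0 <= t /\ (t%:E < eta)%E] (r n).
    by split; [apply: r_ge0; near: n; exact: nbhs_infty_ge|near: n].
  by near: n.
have [rho rho0 rhoU] := nearU _ nU.
pose K := 2 * C / D.
have K0 : 0 < K by rewrite /K divr_gt0// mulr_gt0.
(* The radius [rho] is split in two: this bound caps the length travelled after index [N] by
   [rho / 2], and [x N] is taken within [rho / 2] of [xbar]. *)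
have phi_small : \forall n \near \oo, phi (r n) < rho / 2 / K.
  by apply: (cvgr_lt _ phir); rewrite divr_gt0// divr_gt0.
have [N1 _ N1P] : \forall n \near \oo, [/\ (N0 <= n)%N, ((r n)%:E < eta)%E,
    phi (r n) < rho / 2 / K & `|x n - xbar| < rho -> U (z n)].
  near=> n; split; first by near: n; exact: nbhs_infty_ge.
  - by near: n.
  - by near: n.
  - by near: n; exact: rhoU.
have [N NN1 xN] : exists2 n, (N1 <= n)%N & `|x n - xbar| < rho / 2.
  by apply: clus; rewrite divr_gt0.
pose S j := \sum_(N <= i < N + j) (v i + v i.+1).
have NP j : [/\ (N0 <= N + j)%N, ((r (N + j)%N)%:E < eta)%E,
    phi (r (N + j)%N) < rho / 2 / K & `|x (N + j)%N - xbar| < rho -> U (z (N + j)%N)].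
  by apply: N1P; rewrite /= (leq_trans NN1)// leq_addr.
have phi_ge0 j : 0 <= phi (r (N + j)%N).
  by have [+ _ _ _ _] := dphi; apply; have [/r_ge0] := NP j.
(* Joint induction: the length bound keeps [x] within [rho] of [xbar], hence [z] in [U], where the
   KL inequality extends the telescoped bound by one more term. *)
have inv j : S j <= K * (phi (r N) - phi (r (N + j)%N)) /\
    `|x (N + j)%N - xbar| <= `|x N - xbar| + S j.
  elim: j => [|j [IH1 IH2]]; first by rewrite /S addn0 big_geq// addr0 subrr mulr0.
  have [Nj reta _ hU] := NP j; have [Nj1 reta1 _ _] := NP j.+1.
  have Sj : S j.+1 = S j + (v (N + j)%N + v (N + j).+1).
    by rewrite /S addnS big_nat_recr ?leq_addr.
  have Sphi : S j < rho / 2.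
    apply: (le_lt_trans IH1); rewrite mulrC -ltr_pdivlMr//.
    have [_ _ + _] := NP 0%N; rewrite addn0; apply: le_lt_trans.
    by rewrite gerBl phi_ge0.
  have Uz : U (z (N + j)%N) by apply: hU; lra.
  have rj0 := r_gt0 _ Nj; have rj10 := r_gt0 _ Nj1.
  have kl : 1 <= derive1 phi (r (N + j)%N) * enorm (gradient f (z (N + j)%N)).
    apply: KL => //; first by rewrite -subr_gt0.
    by rewrite -lteBlDl.
  split; last first.
    rewrite Sj addnS addrA; have := xv (N + j)%N; have := v0 (N + j)%N.
    have := ler_normD (x (N + j).+1 - x (N + j)%N) (x (N + j)%N - xbar).
    by rewrite addrA subrK; lra.
  rewrite Sj; move: IH1; rewrite addnS in reta1 rj10 Nj1 *.
  have phi_drop := desingularizing_tangent dphi rj0 reta (ltW rj10) reta1.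
  have dphi0 : 0 < derive1 phi (r (N + j)%N).
    by have [_ _ _ _ /(_ _ rj0 reta)[]] := dphi.
  have drop : D * (v (N + j)%N ^+ 2 + v (N + j).+1 ^+ 2) <= r (N + j)%N - r (N + j).+1.
    by have := desc _ Nj; rewrite /r opprB addrA subrK.
  have := KL_step C0 D0 (v0 (N + j)%N) (v0 (N + j).+1) dphi0 kl
    (gradC (N + j)%N) drop phi_drop.
  by rewrite -/K; lra.
apply: (tail N (K * phi (r N))) => j; have [+ _] := inv j.
rewrite mulrBr lerBrDr; have : \sum_(N <= i < N + j) v i <= S j.
  by apply: ler_sum => i _; rewrite lerDl.
have : 0 <= K * phi (r (N + j)%N) by rewrite mulr_ge0// ltW.
lra.
Unshelve. all: end_near.
Qed.

(** * Cluster points and convergence of sequences of finite length *)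

Section Sequences.
Context {R : realType} {m : nat}.
Implicit Types (x : nat -> 'rV[R]_m) (v : nat -> R).

Lemma bounded_cluster_point x (M : R) : (forall n, `|x n| <= M) ->
  exists xbar, forall e N, 0 < e -> exists2 n, (N <= n)%N & `|x n - xbar| < e.
Proof.
move=> xM; pose A := [set u : 'rV[R]_m | `|u| <= M].
have cA : compact A.
  apply: bounded_closed_compact.
    by exists M; split; [exact: num_real|move=> t Mt u /= /le_trans; apply; exact: ltW].
  apply: (@closed_comp _ _ (fun u : 'rV[R]_m => `|u|) [set t | t <= M]).
    by move=> u _; exact: norm_continuous.
  exact: closed_le.
have [|xbar [_ cl]] := cA (x @ \oo) _; first by exists 0%N => // n _; exact: xM.
exists xbar => e N e0.
have [|_ [[n Nn <-] xn]] := cl (x @` [set n | (N <= n)%N]) _ _ (nbhsx_ballx xbar _ e0).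
  by exists N => // n Nn; exists n.
by exists n => //; rewrite distrC; move: xn; rewrite -ball_normE.
Qed.

(** The remaining length tends to 0, so one late visit near the cluster point confines the whole
    tail of [x] there. *)
Lemma cvg_finite_length x v xbar :
  (forall n, 0 <= v n) -> (forall n, `|x n.+1 - x n| <= v n.+1) ->
  (exists M, forall n, \sum_(i < n) v i <= M) ->
  (forall e N, 0 < e -> exists2 n, (N <= n)%N & `|x n - xbar| < e) ->
  x @ \oo --> xbar.
Proof.
move=> v0 xv [M sM] clus; pose S n := \sum_(i < n) v i.
have S_nd : nondecreasing_seq S.
  by apply/nondecreasing_seqP => n; rewrite /S big_ord_recr/= lerDl.
have cS : cvgn S.
  by apply: nondecreasing_is_cvgn => //; exists M => _ [n _ <-]; exact: sM.
(* [S n] stops at [v n.-1], and the step from [x n] costs [v n.+1]; hence the shift by one in both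
   arguments. *)
have xS n j : `|x (n + j)%N - x n| <= S (n + j).+1 - S n.+1.
  elim: j => [|j IH]; first by rewrite addn0 !subrr normr0.
  rewrite addnS {1}/S big_ord_recr/= -/(S _).
  have := xv (n + j)%N.
  have := ler_normD (x (n + j).+1 - x (n + j)%N) (x (n + j)%N - x n).
  by rewrite addrA subrK; move: IH; lra.
apply/cvgrPdist_lt => e e0; have e20 : 0 < e / 2 by rewrite divr_gt0.
have /cvgrPdist_lt /(_ _ e20) [N _ NP] := cS.
have [n Nn xn] := clus _ N e20.
exists n => // j /= nj; rewrite distrC -(subnKC nj).
have := xS n (j - n)%N.
have : S (n + (j - n)).+1 <= limn S by exact: nondecreasing_cvgn_le.
have /= := NP n.+1 (leq_trans Nn (leqnSn n)).
have := ler_norm (limn S - S n.+1).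
have := ler_normD (x (n + (j - n))%N - x n) (x n - xbar).
rewrite addrA subrK; move: xn; lra.
Qed.

End Sequences.

(** * Momentum coefficients and the one-step energy estimate *)

Lemma momentum_cvg {R : realType} (alpha beta : R) : 0 < alpha -> 0 < beta ->
  beta * n%:R / (n%:R + alpha) @[n --> \oo] --> beta.
Proof.
move=> a0 b0; apply/cvgrPdist_lt => e e0; near=> n.
have na : 0 < n%:R + alpha by rewrite ltr_wpDl.
have -> : beta - beta * n%:R / (n%:R + alpha) = beta * alpha / (n%:R + alpha).
  by field; rewrite gt_eqF.
rewrite gtr0_norm ?divr_gt0 ?mulr_gt0// ltr_pdivrMr// -ltr_pdivrMl//.
rewrite (@lt_trans _ _ n%:R)// ?ltrDl//.
by near: n; exact: nbhs_infty_gtr.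
Unshelve. all: end_near.
Qed.

Section Coefficients.
Context {R : realType}.
Implicit Types L s b c : R.

(* Expanding the descent lemma between consecutive [y]s with momentum coefficients
   [b] and [c] produces [cross_coef] times the inner product of the increments of
   [x], split evenly between their squares. *)
Definition cross_coef L s b c := b * ((2 + c) / s - L * (1 + c)).

Definition new_coef L s b c :=
  cross_coef L s b c / 2 + (L / 2 * ((1 + c) * (1 + c)) - (1 + c) / s).

Definition old_coef L s b c := cross_coef L s b c / 2 + b * b * (L / 2 - s^-1).

(** The recursion expresses the gradient at [p] through the increments, so the descent lemma becomes
    a quadratic form in [u] and [v]. Its cross coefficient is nonnegative, which permits 2 <u, v> <=
    |u|^2 + |v|^2. *)
Lemma energy_step {m} (g : 'rV[R]_m -> R) L s (beta : R) b c (p q u v : 'rV[R]_m) :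
  (forall x, differentiable g x) ->
  (forall x y, enorm (gradient g x - gradient g y) <= L * enorm (x - y)) ->
  0 <= L -> 0 < s -> s * L < 2 * (1 - beta) -> 0 <= b -> 0 <= c <= beta ->
  v = b *: u - s *: gradient g p -> q = p + ((1 + c) *: v - b *: u) ->
  g q <= g p + new_coef L s b c * enorm v ^+ 2 + old_coef L s b c * enorm u ^+ 2.
Proof.
move=> dg lipg L0 s0 sL b0 /andP[c0 cb] vE qE.
have gE : gradient g p = s^-1 *: (b *: u - v).
  by rewrite vE opprB addrC subrK scalerA mulVf ?scale1r// gt_eqF.
have cross0 : 0 <= cross_coef L s b c.
  rewrite mulr_ge0// subr_ge0 ler_pdivlMr//.
  have : 0 <= c * beta by rewrite mulr_ge0// (le_trans c0).
  have : (1 + c) * (s * L) <= (1 + c) * (2 * (1 - beta)).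
    by rewrite ler_wpM2l ?addr_ge0// ltW.
  lra.
have := descent_lemma g L p q dg lipg; have -> : q - p = (1 + c) *: v - b *: u.
  by rewrite qE addrAC subrr add0r.
move=> /le_trans; apply; rewrite gE !enorm_sqr !dotE (dotC v u).
have /(ler_wpM2l cross0) : 2 * dot u v <= dot u u + dot v v.
  by have := sqr_ge0 (enorm (u - v)); rewrite enorm_sqr !dotE (dotC v u); lra.
rewrite /new_coef /old_coef /cross_coef; lra.
Qed.

(** At the limiting momentum the sum collapses to (s L - 2 (1 - beta)) / (2 s), so the bound on [s]
    is exactly its sign condition. *)
Lemma coef_sum_lt0 L s (beta : R) : 0 < s -> s * L < 2 * (1 - beta) ->
  new_coef L s beta beta + old_coef L s beta beta < 0.
Proof.
move=> s0 sL.
have -> : new_coef L s beta beta + old_coef L s beta beta =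
    (s * L - 2 * (1 - beta)) / (2 * s).
  by rewrite /new_coef /old_coef /cross_coef; field; rewrite gt_eqF.
by rewrite pmulr_llt0 ?invr_gt0 ?mulr_gt0// subr_lt0.
Qed.

(** Ensures a positive weight on the kinetic term, so that the energy inherits a lower bound from
    [g] and the weight has a real square root. *)
Lemma coef_sub_gt0 L s (beta : R) : 0 < s -> 0 < beta -> s * L < 2 * (1 - beta) ->
  0 < old_coef L s beta beta - new_coef L s beta beta.
Proof.
move=> s0 b0 sL.
have -> : old_coef L s beta beta - new_coef L s beta beta =
    (2 * (1 + beta - beta ^+ 2) - (1 + 2 * beta) * (s * L)) / (2 * s).
  by rewrite /new_coef /old_coef /cross_coef; field; rewrite gt_eqF.
rewrite divr_gt0 ?mulr_gt0//.
have : (1 + 2 * beta) * (s * L) < (1 + 2 * beta) * (2 * (1 - beta)).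
  by rewrite ltr_pM2l// addr_gt0// mulr_gt0.
by have := sqr_ge0 beta; lra.
Qed.

Lemma coef_cvg L s (beta : R) (b c : nat -> R) :
  b @ \oo --> beta -> c @ \oo --> beta ->
  new_coef L s (b n) (c n) @[n --> \oo] --> new_coef L s beta beta /\
  old_coef L s (b n) (c n) @[n --> \oo] --> old_coef L s beta beta.
Proof.
move=> cb cc.
have c1 : 1 + c n @[n --> \oo] --> 1 + beta by apply: cvgD => //; exact: cvg_cst.
have c2 : 2 + c n @[n --> \oo] --> 2 + beta by apply: cvgD => //; exact: cvg_cst.
have cross : cross_coef L s (b n) (c n) / 2 @[n --> \oo] -->
    cross_coef L s beta beta / 2.
  apply: cvgMr_tmp; apply: cvgM => //; apply: cvgB; first exact: cvgMr_tmp.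
  exact: cvgMl_tmp.
split; apply: cvgD => //; last by apply: cvgMr_tmp; exact: cvgM.
by apply: cvgB; [apply: cvgMl_tmp; exact: cvgM|exact: cvgMr_tmp].
Qed.

End Coefficients.

(** * Energy decrease, finite length and the limit for the inertial gradient iteration *)

Theorem theorem7 (R : realType) (m : nat) (g : 'rV[R]_m -> R) (Lg : R)
  (g_diff : forall x, differentiable g x)
  (Lg_ge0 : 0 <= Lg)
  (g_lip : forall x y,
     enorm (gradient g x - gradient g y) <= Lg * enorm (x - y))
  (g_lb : has_lbound (range g))
  (alpha beta s : R)
  (alpha_gt0 : 0 < alpha)
  (beta_gt0 : 0 < beta) (beta_lt1 : beta < 1)
  (s_gt0 : 0 < s) (s_lt : s * Lg < 2 * (1 - beta))
  (x y : nat -> 'rV[R]_m)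
  (xy0 : x 0%N = y 0%N)
  (x_rec : forall n : nat, x n.+1 = y n - s *: gradient g (y n))
  (y_rec : forall n : nat, (1 <= n)%N ->
     y n = x n + (beta * n%:R / (n%:R + alpha)) *: (x n - x n.-1))
  (x_bounded : exists M : R, forall n : nat, enorm (x n) <= M)
  (H_KL : KL_function (on_product (H g))) :
  (\sum_(1 <= n <oo) (enorm (x n - x n.-1))%:E < +oo)%E /\
  (exists xbar : 'rV[R]_m, crit g xbar /\ x @ \oo --> xbar).
Proof.
pose b n : R := beta * n%:R / (n%:R + alpha).
pose v n := x n - x n.-1.
pose ev n := enorm (v n).
have ev0 n : 0 <= ev n by exact: enorm_ge0.
(* Since [0.-1] is [0], [v 0] is zero and the formula for [y] also covers the starting point. *)
have yE n : y n = x n + b n *: v n.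
  by case: n => [|n]; [rewrite /v subrr scaler0 addr0|exact: y_rec].
have b_ge0 n : 0 <= b n by rewrite divr_ge0 ?mulr_ge0 ?addr_ge0// ltW.
have b_le n : b n <= beta.
  by rewrite ler_pdivrMr ?ltr_wpDl// ler_wpM2l ?(ltW beta_gt0)// lerDl ltW.
have b_le1 n : b n <= 1 by rewrite (le_trans (b_le n))// ltW.
have vE n : v n.+1 = b n *: v n - s *: gradient g (y n).
  by rewrite [LHS]/v/= x_rec {1}(yE n) addrAC (addrC (x n)) addrK.
have yS n : y n.+1 = y n + ((1 + b n.+1) *: v n.+1 - b n *: v n).
  have xS : x n.+1 = x n + v n.+1 by rewrite addrC subrK.
  rewrite [LHS]yE xS yE scalerDl scale1r.
  by rewrite (addrC _ (- (b n *: v n))) [RHS]addrA addrK [RHS]addrA.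
(* The midpoint choice makes the limits of [new_coef + delta] and [old_coef - delta]
   coincide. *)
pose delta := (old_coef Lg s beta beta - new_coef Lg s beta beta) / 2.
have delta0 : 0 < delta by rewrite divr_gt0// coef_sub_gt0.
(* Both shifted coefficients tend to -2 [D], so they are eventually below -[D]. *)
pose D := - (new_coef Lg s beta beta + old_coef Lg s beta beta) / 4.
have D0 : 0 < D by rewrite divr_gt0// oppr_gt0 coef_sum_lt0.
pose E n := g (y n) + delta * ev n ^+ 2.
have [N0 _ descE] : \forall n \near \oo,
    D * (ev n ^+ 2 + ev n.+1 ^+ 2) <= E n - E n.+1.
  have cb : b @ \oo --> beta by exact: momentum_cvg.
  have cb1 : b n.+1 @[n --> \oo] --> beta by rewrite cvg_shiftS.
  have [cn co] := coef_cvg Lg s beta _ _ cb cb1.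
  near=> n.
  have nD : new_coef Lg s (b n) (b n.+1) < - D - delta.
    by near: n; apply: (cvgr_lt _ cn); rewrite /delta /D; move: D0; rewrite /D; lra.
  have oD : old_coef Lg s (b n) (b n.+1) < delta - D.
    by near: n; apply: (cvgr_lt _ co); rewrite /delta /D; move: D0; rewrite /D; lra.
  have := energy_step g Lg s beta (b n) (b n.+1) _ _ _ _ g_diff g_lip Lg_ge0 s_gt0 s_lt
    (b_ge0 n) _ (vE n) (yS n); rewrite b_ge0 b_le => /(_ isT).
  have := ler_wpM2r (sqr_ge0 (ev n.+1)) (ltW nD).
  have := ler_wpM2r (sqr_ge0 (ev n)) (ltW oD).
  by rewrite /E -/(ev n) -/(ev n.+1); lra.
have cE : cvgn E.
  have [l lP] := g_lb; apply: (@near_nonincreasing_is_cvgn _ E l).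
    exists N0 => // n /= Nn j nj; rewrite -(subnKC nj); elim: (j - n)%N => [|i IH].
      by rewrite addn0.
    rewrite addnS; apply: le_trans IH; rewrite -subr_ge0.
    apply: le_trans (descE _ (leq_trans Nn (leq_addr _ _))).
    by rewrite mulr_ge0 ?(ltW D0)// addr_ge0 ?sqr_ge0.
  apply: nearW => n; apply: ler_wpDr; last by apply: lP; exists (y n).
  exact: mulr_ge0 (ltW delta0) (sqr_ge0 _).
have ev_small e : 0 < e -> \forall n \near \oo, ev n < e.
  move=> e0.
  have dE : E n - E n.+1 @[n --> \oo] --> 0.
    rewrite -(subrr (limn E)); apply: cvgB => //.
    by rewrite cvg_shiftS.
  near=> n; rewrite -(ltr_pXn2r (n := 2)) ?nnegrE ?ev0 ?(ltW e0)//.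
  rewrite -(ltr_pM2l D0); apply: (@le_lt_trans _ _ (E n - E n.+1)); last first.
    by near: n; apply: (cvgr_lt _ dE); rewrite mulr_gt0 ?exprn_gt0.
  have /descE : (N0 <= n)%N by near: n; exact: nbhs_infty_ge.
  by apply: le_trans; rewrite ler_pM2l// lerDl sqr_ge0.
have [M xM] := x_bounded.
have [xbar clus] := bounded_cluster_point x M
  (fun n => le_trans (norm_le_enorm _) (xM n)).
pose kappa := Num.sqrt (2 * delta).
have kappa0 : 0 <= kappa by exact: sqrtr_ge0.
pose z n := row_mx (y n) (y n + kappa *: v n).
pose zbar := row_mx xbar xbar.
pose F := on_product (H g).
have FE n : F (z n) = E n.
  rewrite /F /on_product /H row_mxKl row_mxKr addrAC subrr add0r enormZ.
  rewrite ger0_norm// exprMn sqr_sqrtr; last by rewrite mulr_ge0// ltW.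
  by rewrite /E /ev; field.
have nearU U : nbhs zbar U -> exists2 rho : R, 0 < rho &
    \forall n \near \oo, `|x n - xbar| < rho -> U (z n).
  (* The distance from [z n] to [zbar] is at most 2 |x_n - xbar| + (2 + kappa) |v_n|; each of the
     two terms gets [rho / 2]. *)
  move=> /nbhs_ballP[rho /= rho0 hU]; exists (rho / 4); first by rewrite divr_gt0.
  near=> n => xn; apply: hU; rewrite -ball_normE/= distrC.
  rewrite opp_row_mx add_row_mx (le_lt_trans (norm_row_mx_le _ _))//.
  have vn : (2 + kappa) * ev n < rho / 2.
    rewrite mulrC -ltr_pdivlMr ?ltr_pwDl//.
    by near: n; apply: ev_small; rewrite !divr_gt0// ltr_pwDl.
  have yx : `|y n - xbar| <= `|x n - xbar| + ev n.
    rewrite yE addrAC (le_trans (ler_normD _ _))// lerD2l normrZ ger0_norm//.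
    by rewrite (le_trans (ler_wpM2r _ (b_le1 n)))// mul1r norm_le_enorm.
  have := ler_normD (y n - xbar) (kappa *: v n).
  rewrite normrZ ger0_norm// addrAC.
  have : kappa * `|v n| <= kappa * ev n by rewrite ler_wpM2l// norm_le_enorm.
  lra.
have FzE : F (z n) @[n --> \oo] --> F zbar.
  have -> : (fun n => F (z n)) = E by apply/funext.
  (* The energies converge as a whole, and by continuity they come arbitrarily close to [F zbar] at
     late indices where [x] visits [xbar]. *)
  suff -> : F zbar = limn E by [].
  apply/eqP; rewrite -subr_eq0 -normr_le0; apply/ler_addgt0Pl => e e0.
  have e20 : 0 < e / 2 by rewrite divr_gt0.
  have /cvgrPdist_lt/(_ _ e20) nF := differentiable_continuous (H_KL.1 zbar).
  have [rho rho0 rhoF] := nearU _ nF.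
  have /cvgrPdist_lt/(_ _ e20) nE := cE.
  have [N1 _ N1P] := filterI rhoF nE.
  have [n Nn xn] := clus rho N1 rho0; have [/(_ xn) /= Fn En] := N1P n Nn.
  have := ler_normB (F zbar - F (z n)) (limn E - E n).
  have -> : F zbar - F (z n) - (limn E - E n) = F zbar - limn E by rewrite FE; ring.
  by move: Fn En; rewrite /F; lra.
(* Each block of the gradient of [F] contributes one [kappa]; the gradient of [g] contributes
   [s^-1]. *)
pose C := s^-1 + 2 * kappa.
have C0 : 0 < C by rewrite ltr_pwDl ?invr_gt0// mulr_ge0.
have gradg n : enorm (gradient g (y n)) <= s^-1 * (ev n + ev n.+1).
  have -> : gradient g (y n) = s^-1 *: (b n *: v n - v n.+1).
    by rewrite vE opprB addrC subrK scalerA mulVf ?scale1r// gt_eqF.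
  rewrite enormZ gtr0_norm ?invr_gt0// ler_pM2l ?invr_gt0//.
  rewrite (le_trans (enormD _ _))// enormN lerD2r enormZ ger0_norm//.
  by rewrite (le_trans (ler_wpM2r _ (b_le1 n))) ?mul1r ?enorm_ge0.
have gradF n : enorm (gradient F (z n)) <= C * (ev n + ev n.+1).
  rewrite gradient_on_product_H// (le_trans (enorm_row_mx_le _ _))//.
  have := enormD (gradient g (y n)) (y n - (y n + kappa *: v n)).
  rewrite (enormB (y n)) (addrAC (y n)) subrr add0r enormZ ger0_norm// -/(ev n).
  have := gradg n; have := mulr_ge0 kappa0 (ev0 n.+1).
  by rewrite /C; lra.
have xv n : `|x n.+1 - x n| <= ev n.+1 by exact: norm_le_enorm.
have desc n : (N0 <= n)%N -> D * (ev n ^+ 2 + ev n.+1 ^+ 2) <= F (z n) - F (z n.+1).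
  by move=> /descE; rewrite !FE.
have fl := KL_finite_length F zbar z xbar x ev C D N0 (H_KL.2 zbar) C0 D0 ev0 xv desc
  gradF FzE nearU clus.
have cx : x @ \oo --> xbar by exact: cvg_finite_length ev0 xv fl clus.
split.
  have [B sB] := fl.
  apply: (@le_lt_trans _ _ B%:E); last exact: ltry.
  apply: lime_le; first by apply: is_cvg_nneseries => n _ _; rewrite lee_fin enorm_ge0.
  apply: nearW => n; rewrite sumEFin lee_fin; apply: le_trans (sB n).
  rewrite -(big_mkord xpredT ev).
  case: n => [|n]; first by rewrite !big_geq.
  by rewrite [leRHS]big_ltn// lerDr.
exists xbar; split=> //; apply: enorm_eq0.
apply/eqP; rewrite eq_le enorm_ge0 andbT; apply/ler_addgt0Pl => e e0.
(* Compare the gradient at [xbar] with that at [y n]: [2 * s^-1] bounds the latter through two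
   increments below [t], and [Lg * (m%:R + 1)] bounds the difference, [m%:R] coming from the norm
   comparison and 1 from the momentum term. *)
pose K := 2 * s^-1 + Lg * (m%:R + 1) + 1.
have K0 : 0 < K by rewrite ltr_wpDl// addr_ge0 ?mulr_ge0 ?invr_ge0 ?addr_ge0// ltW.
have [t t0 ->] : exists2 t, 0 < t & e = K * t.
  by exists (e / K); rewrite ?divr_gt0// mulrC divfK// gt_eqF.
near \oo => n.
have vn : ev n < t by near: n; exact: ev_small.
have vn1 : ev n.+1 < t.
  near: n; have [N _ NP] := ev_small _ t0.
  by exists N => // j /= Nj; apply: NP; exact: leqW.
have xn : `|xbar - x n| < t by near: n; move/cvgrPdist_lt : cx; exact.
have dy : enorm (xbar - y n) <= (m%:R + 1) * t.
  rewrite yE opprD addrA (le_trans (enormD _ _))// enormN enormZ.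
  rewrite ger0_norm// mulrDl mul1r.
  apply: lerD; first by rewrite (le_trans (enorm_le_norm _))// ler_wpM2l// ltW.
  by rewrite (le_trans (ler_wpM2r _ (b_le1 n))) ?enorm_ge0// mul1r ltW.
have := enormD (gradient g xbar - gradient g (y n)) (gradient g (y n)).
rewrite subrK; move=> /le_trans; apply; rewrite addr0.
have := le_trans (g_lip xbar (y n)) (ler_wpM2l Lg_ge0 dy).
have := gradg n.
have : s^-1 * (ev n + ev n.+1) <= s^-1 * (t + t).
  by rewrite ler_pM2l ?invr_gt0// lerD// ltW.
by have := t0; rewrite /K; lra.
Unshelve. all: end_near.
Qed.
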